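(* Let $k\ge 3$ and $1\le \ell\le k-1$ be integers. Let $G$ be a simple graph with $n\ge 1$ vertices and $m$ edges. Then there is a balanced partition of $V(G)$ into $k$ sets $V_1,\ldots,V_k$ such that $$\max_{A\in\binom{[k]}{\ell}} e_G\Bigl(\bigcup_{i\in A}V_i\Bigr)\le \frac{\ell^2}{k^2}m+\frac{\ell^2(k-\ell)}{k^2}(n-1)+\frac{\ell(k-\ell)}{k(k-1)}\sqrt{\Bigl(\binom{k}{\ell}-1\Bigr)m}.$$
   Context: All graphs are finite and simple. $[k]=\{1,\ldots,k\}$ and $\binom{[k]}{\ell}$ is the family of all $\ell$-element subsets of $[k]$. For $S\subseteq V(G)$, $e_G(S)$ is the number of edges of $G$ with both endpoints in $S$. A partition $V(G)=V_1\cup\cdots\cup V_k$ into pairwise disjoint sets (parts may be empty) is called balanced if $\bigl||V_i|-|V_j|\bigr|\le 1$ for all $i,j\in[k]$. *)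

(* Defs.v *)
From mathcomp Require Import all_boot all_order all_algebra.

Set Implicit Arguments.
Unset Strict Implicit.
Unset Printing Implicit Defensive.

Import Order.TTheory GRing.Theory Num.Theory.

Local Open Scope ring_scope.

(* A simple graph on V is given by a symmetric and irreflexive relation; these
   two properties are hypotheses of the theorem, not part of the definitions. *)

Definition edges (V : finType) (adj : rel V) : {set {set V}} :=
  [set [set p.1; p.2] | p : V * V & adj p.1 p.2].

Definition edges_within (V : finType) (adj : rel V) (S : {set V}) : nat :=
  #|[set E in edges adj | E \subset S]|.

(* An indexed family rather than finset's [partition], which excludes empty
   blocks. *)
Definition is_kpartition (V : finType) (k : nat) (P : 'I_k -> {set V}) : Prop :=
  (forall i j, i != j -> [disjoint P i & P j]) /\
  \bigcup_(i < k) P i = [set: V].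

Definition balanced (V : finType) (k : nat) (P : 'I_k -> {set V}) : Prop :=
  forall i j, `|#|P i|%:Z - #|P j|%:Z| <= 1.

(* Main.v *)
Require Import Defs.
From mathcomp Require Import all_boot all_order all_fingroup all_algebra.
From mathcomp Require Import ring lra zify.

Set Implicit Arguments.
Unset Strict Implicit.
Unset Printing Implicit Defensive.

Import Order.TTheory GRing.Theory Num.Theory.

Local Open Scope ring_scope.

(** Why the bound holds.

    List the vertices by decreasing degree and cut the list into blocks of k
    consecutive vertices, the last block possibly incomplete.  Colour each
    block by an independent uniformly random bijection from its k places to
    the k colours.  Every colour class then meets each full block exactly once
    and the incomplete one at most once, so every outcome is balanced.

    Fix a set A of l colours, put p = l / k, and let y_v be 1 - p or - p
    according to whether the colour of v is in A.  The number of edges inside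
    the union of the classes of A is
      p ^ 2 m + p (sum of deg v * y_v) + (sum over edges uv of y_u y_v).

    The linear term is bounded for every outcome: since y sums to 0 on a
    block, a block contributes at most l (k - l) / k times the drop of the
    degree along it, and the drops add up to at most n - 1 ([linear_le]).

    The quadratic term is controlled in mean square.  Split it according to
    the pair of blocks containing the two ends of an edge, and centre the
    contributions of the edges inside a single block.  The pieces are pairwise
    orthogonal ([mean_sum_sqr_orthogonal]), because the average of a piece over
    any block on which it depends vanishes.  With
    s = l (k - l) / (k (k - 1)), the piece of two distinct blocks has second
    moment at most s ^ 2 times its number of edges, by applying the
    covariance bound [mean_linear_sqr_le] to each block in turn.  The same
    bound holds inside one block ([mean_block_sqr_le]), but there it needs the
    fourth moments of y, together with inequalities on sums of squares of
    degrees.  Centring only adds a nonnegative constant, because two distinct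
    places of a block are negatively correlated.

    Thus the centred quadratic terms z_A have mean 0 and second moment at most
    s ^ 2 m.  In a family of N numbers, the maximum exceeds the average by at
    most sqrt (N - 1) standard deviations; in averaged form ([exists_all_le])
    this produces one outcome with z_A <= s sqrt ((N - 1) m) for all
    N = 'C(k, l) sets A at the same time. *)

(** * Averages over a finite sample space *)

Definition mean (R : rcfType) (T : finType) (F : T -> R) : R :=
  (\sum_t F t) / #|T|%:R.

Section Mean.
Variables (R : rcfType) (T : finType).
Implicit Types F G : T -> R.

Lemma eq_mean F G : F =1 G -> mean F = mean G.
Proof. by move=> FG; rewrite /mean (eq_bigr G). Qed.

Lemma meanD F G : mean (fun t => F t + G t) = mean F + mean G.
Proof. by rewrite /mean big_split mulrDl. Qed.

Lemma meanZ c F : mean (fun t => c * F t) = c * mean F.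
Proof. by rewrite /mean -mulr_sumr mulrA. Qed.

Lemma meanZr c F : mean (fun t => F t * c) = mean F * c.
Proof. by rewrite -[RHS]mulrC -meanZ; apply: eq_mean => t; rewrite mulrC. Qed.

Lemma mean_sum (I : finType) (P : pred I) (F : I -> T -> R) :
  mean (fun t => \sum_(i | P i) F i t) = \sum_(i | P i) mean (F i).
Proof. by rewrite /mean exchange_big -mulr_suml. Qed.

Lemma mean_cst (c : R) : (0 < #|T|)%N -> mean (fun _ : T => c) = c.
Proof.
move=> T0; rewrite /mean sumr_const cardT -cardE -[c *+ _]mulr_natr mulfK //.
by rewrite pnatr_eq0 -lt0n.
Qed.

Lemma mean0 : mean (fun _ : T => 0 : R) = 0.
Proof. by rewrite /mean big1 ?mul0r. Qed.

Lemma ler_mean F G : (forall t, F t <= G t) -> mean F <= mean G.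
Proof.
by move=> FG; rewrite /mean ler_wpM2r ?invr_ge0 ?ler0n // ler_sum.
Qed.

Lemma ltr_mean F G : (0 < #|T|)%N -> (forall t, F t < G t) -> mean F < mean G.
Proof.
move=> T0 FG; rewrite /mean ltr_pM2r ?invr_gt0 ?ltr0n //.
case/card_gt0P: (T0) => t0 _; rewrite (bigD1 t0) //= [ltRHS](bigD1 t0) //=.
by rewrite ltr_leD // ler_sum // => t _; apply: ltW.
Qed.

Lemma mean_reindex (h : T -> T) F :
  bijective h -> mean (fun t => F (h t)) = mean F.
Proof.
by move=> bh; congr (_ / _); rewrite [RHS](reindex h) //; apply: onW_bij.
Qed.

End Mean.

Section Selection.
Variables (R : rcfType) (T J : finType).

(** If every outcome f had a coordinate z f j > t, then
    (N - 1) (sum of squares) + 2 t (sum) > N t ^ 2 would hold for every f, by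
    Cauchy-Schwarz on the other N - 1 coordinates; averaging over f contradicts
    the moment hypotheses. *)
Lemma exists_all_le (z : T -> J -> R) (t v : R) :
  (0 < #|T|)%N -> (1 < #|J|)%N -> 0 <= t ->
  (#|J|%:R - 1) * v <= t ^+ 2 ->
  (forall j, mean (z^~ j) = 0) ->
  (forall j, mean (fun f => z f j ^+ 2) <= v) ->
  exists f, forall j, z f j <= t.
Proof.
move=> T0 J1 t0 vt z0 z2.
set N : R := #|J|%:R in vt *.
have N1 : 1 < N by rewrite ltr1n.
case: (boolP [exists f, [forall j, z f j <= t]]) => [/existsP[f /forallP]|].
  by exists f.
rewrite negb_exists => /forallP noz; exfalso.
pose S f := \sum_j z f j.
have key f : N * t ^+ 2 < (N - 1) * (\sum_j z f j ^+ 2) + 2 * t * S f.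
  have := noz f; rewrite negb_forall => /existsP[j]; rewrite -ltNge => zt.
  have CS : (S f - z f j) ^+ 2 <= (N - 1) * (\sum_j z f j ^+ 2 - z f j ^+ 2).
    have -> : S f - z f j = \sum_(i | i != j) z f i.
      by rewrite /S (bigD1 j) //= [X in X - _]addrC addrK.
    have -> : \sum_i z f i ^+ 2 - z f j ^+ 2 = \sum_(i | i != j) z f i ^+ 2.
      by rewrite (bigD1 j) //= [X in X - _]addrC addrK.
    set a := \sum_(i | _) z f i; set b := \sum_(i | _) _ ^+ 2.
    have aE : a = \sum_(i | i != j) z f i by [].
    clearbody a.
    have NE : \sum_(i | i != j) 1 = N - 1 :> R.
      rewrite /N -sum1_card natr_sum [in RHS](bigD1 j) //=.
      by rewrite [X in X - _]addrC addrK.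
    have : 0 <= \sum_(i | i != j) ((N - 1) * z f i - a) ^+ 2.
      by apply: sumr_ge0 => i _; apply: sqr_ge0.
    have -> : \sum_(i | i != j) ((N - 1) * z f i - a) ^+ 2 =
      (N - 1) ^+ 2 * b - 2 * (N - 1) * a * (\sum_(i | i != j) z f i)
        + a ^+ 2 * (N - 1).
      rewrite -[X in _ + _ * X]NE /b !mulr_sumr.
      rewrite -sumrB -big_split /=.
      by apply: eq_bigr => i _; ring.
    rewrite -aE => h; have : 0 <= (N - 1) * ((N - 1) * b - a ^+ 2) by nra.
    by rewrite pmulr_rge0 ?subr_gt0 // subr_ge0.
  move: CS; set Q := \sum_j _ ^+ 2; set s := S f; set z1 := z f j in zt *.
  move=> CS.
  (* The difference of the two sides is at least
     (s - (z1 - t))^2 + (N - 1) (z1 - t)^2 + 2 t N (z1 - t). *)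
  have sq := sqr_ge0 (s - (z1 - t)).
  have d1 : 0 < (N - 1) * (z1 - t) ^+ 2.
    by rewrite mulr_gt0 ?exprn_gt0 ?subr_gt0.
  have d2 : 0 <= t * N * (z1 - t).
    by rewrite !mulr_ge0 ?subr_ge0 ?(ltW zt) // (ltW (lt_trans ltr01 N1)).
  nra.
have : mean (fun _ : T => N * t ^+ 2) <
       mean (fun f => (N - 1) * (\sum_j z f j ^+ 2) + 2 * t * S f).
  exact: ltr_mean.
rewrite mean_cst // meanD !meanZ /S !mean_sum [X in _ + _ * X]big1 //.
rewrite mulr0 addr0.
apply/negP; rewrite -leNgt.
have h : \sum_i mean (fun f => z f i ^+ 2) <= N * v.
  apply: le_trans (_ : \sum_(i : J) v <= _); first exact: ler_sum.
  by rewrite sumr_const mulr_natl.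
apply: le_trans (_ : (N - 1) * (N * v) <= _).
  by rewrite ler_pM2l ?subr_gt0.
by rewrite mulrCA ler_pM2l // (lt_trans ltr01).
Qed.

End Selection.

Section ProductSpace.
Variables (R : rcfType) (I T : finType).
Hypothesis T0 : (0 < #|T|)%N.
Implicit Types (f : {ffun I -> T}) (F G : {ffun I -> T} -> R).

Definition resample f i t : {ffun I -> T} :=
  [ffun j => if j == i then t else f j].

Lemma resample_eq f i t : resample f i t i = t.
Proof. by rewrite ffunE eqxx. Qed.

Lemma resample_neq f i t j : j != i -> resample f i t j = f j.
Proof. by move=> ji; rewrite ffunE (negbTE ji). Qed.

(** The map (f, t) |-> (f with f i replaced by t, f i) is an involution. *)
Lemma mean_resample F i :
  mean F = mean (fun f => mean (fun t => F (resample f i t))).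
Proof.
rewrite [in RHS]/mean -mulr_suml; congr (_ / _).
rewrite pair_big /=.
pose sg (p : {ffun I -> T} * T) := (resample p.1 i p.2, p.1 i).
have sgK : involutive sg.
  case=> f t; rewrite /sg /= resample_eq; congr (_, _).
  apply/ffunP => j; have [->|ji] := eqVneq j i; first by rewrite resample_eq.
  by rewrite !resample_neq.
rewrite (reindex_inj (inv_inj sgK)) /=.
rewrite (eq_bigr (fun p => F p.1)); last first.
  case=> f t _; congr F; rewrite /=.
  apply/ffunP => j; have [->|ji] := eqVneq j i; first by rewrite resample_eq.
  by rewrite !resample_neq.
rewrite -(pair_big xpredT xpredT (fun f (_ : T) => F f)) /=.
rewrite [in RHS](eq_bigr (fun f => F f * #|T|%:R)); last first.
  by move=> f _; rewrite sumr_const mulr_natr.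
by rewrite -mulr_suml mulfK // pnatr_eq0 -lt0n.
Qed.

Lemma mean_orthogonal F G i :
  (forall f t, G (resample f i t) = G f) ->
  (forall f, mean (fun t => F (resample f i t)) = 0) ->
  mean (fun f => F f * G f) = 0.
Proof.
move=> GI F0; rewrite (mean_resample _ i) -[RHS](@mean0 R {ffun I -> T}).
apply: eq_mean => f; rewrite -[RHS](mul0r (G f)) -(F0 f) -meanZr.
by apply: eq_mean => t; rewrite GI.
Qed.

(** Hoeffding's orthogonality: when two supports differ, some coordinate i lies
    in exactly one of them, and averaging over i alone kills the product. *)
Lemma mean_sum_sqr_orthogonal (J : finType) (P : pred J) (supp : J -> {set I})
    (X : J -> {ffun I -> T} -> R) :
  (forall j j', P j -> P j' -> supp j = supp j' -> j = j') ->
  (forall j i f t, i \notin supp j -> X j (resample f i t) = X j f) ->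
  (forall j i f, P j -> i \in supp j ->
     mean (fun t => X j (resample f i t)) = 0) ->
  mean (fun f => (\sum_(j | P j) X j f) ^+ 2) =
  \sum_(j | P j) mean (fun f => X j f ^+ 2).
Proof.
move=> supp_inj Xdep Xcent.
have orth j j' : P j -> P j' -> j' != j -> mean (fun f => X j f * X j' f) = 0.
  move=> Pj Pj' jj'.
  have : supp j != supp j'.
    by apply: contraNneq jj' => /(supp_inj _ _ Pj Pj') ->.
  rewrite eqEsubset negb_and => /orP[] /subsetPn[i i1 i2].
    apply: (mean_orthogonal (i := i)) => [f t|f]; first exact: Xdep.
    exact: Xcent.
  rewrite (eq_mean (G := fun f => X j' f * X j f)); last first.
    by move=> f; rewrite mulrC.
  apply: (mean_orthogonal (i := i)) => [f t|f]; first exact: Xdep.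
  exact: Xcent.
transitivity (\sum_(j | P j) \sum_(j' | P j') mean (fun f => X j f * X j' f)).
  rewrite (eq_mean
    (G := fun f => \sum_(j | P j) \sum_(j' | P j') X j f * X j' f)).
    by rewrite mean_sum; apply: eq_bigr => j _; rewrite mean_sum.
  move=> f; rewrite expr2 mulr_suml.
  by apply: eq_bigr => j _; rewrite mulr_sumr.
apply: eq_bigr => j Pj; rewrite (bigD1 j) //= [X in _ + X]big1 ?addr0.
  by apply: eq_mean => f; rewrite expr2.
by move=> j' /andP[Pj' jj']; apply: orth.
Qed.

End ProductSpace.

(** * Moments of a randomly permuted vector *)

(** Here y_i = a (f i) for a uniformly random permutation f.  The numbers a z
    sum to 0 and are roots of one quadratic X^2 - r X - q, as the centred
    indicator of a set is.  Exchangeability and these two facts determine all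
    joint moments up to order four: a factor y_w with w new can be replaced by
    minus the sum of the y_v over the places already present, and y_i ^ 2
    reduces to degree one.  The names record the exponents at distinct places:
    [mean_211] is the mean of y_u ^ 2 y_v y_w. *)
Section Moments.
Variables (R : rcfType) (k : nat) (a : 'I_k -> R) (q r : R).
Hypothesis k3 : (3 <= k)%N.
Hypothesis a2 : forall z, a z ^+ 2 = r * a z + q.
Hypothesis a0 : \sum_z a z = 0.

Let T : finType := 'S_k.
Let K : R := k%:R.

Let cardT0 : (0 < #|T|)%N.
Proof. by apply/card_gt0P; exists 1%g. Qed.

Lemma sum_perm_val (f : 'S_k) : \sum_i a (f i) = 0.
Proof. by rewrite -[RHS]a0 [RHS](reindex_inj (@perm_inj _ f)). Qed.

(** P depends only on the places in s, so P y_w has the same mean for all w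
    outside s, and the total over all w is 0. *)
Lemma mean_exchange (P : 'S_k -> R) (s : seq 'I_k) (w : 'I_k) :
  uniq s -> w \notin s ->
  (forall w' (f : 'S_k), w' \notin s -> P (tperm w w' * f)%g = P f) ->
  (K - (size s)%:R) * mean (fun f : T => P f * a (f w)) =
  - \sum_(v <- s) mean (fun f : T => P f * a (f v)).
Proof.
move=> us ws Pinv; apply/eqP; rewrite -addr_eq0; apply/eqP.
have : mean (fun f : T => \sum_v P f * a (f v)) = 0.
  rewrite -[RHS](@mean0 R T); apply: eq_mean => f.
  by rewrite -mulr_sumr sum_perm_val mulr0.
rewrite mean_sum (bigID (mem s)) /= -big_uniq //= => sum0; rewrite -[RHS]sum0.
rewrite addrC; congr (_ + _).
rewrite (eq_bigr (fun _ => mean (fun f : T => P f * a (f w)))); last first.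
  move=> v vs; rewrite -(mean_reindex (h := mulg (tperm w v))).
    by apply: eq_mean => f; rewrite Pinv // permM tpermR.
  by exists (mulg (tperm w v)^-1) => x; rewrite ?mulKg ?mulKVg.
rewrite sumr_const -[RHS]mulr_natl; congr (_ * _).
have -> : K = (size s)%:R + #|[predC s]|%:R.
  by rewrite -natrD -(card_uniqP us) cardC card_ord.
by rewrite addrC addKr; congr (_%:R); apply: eq_card => i; rewrite !inE.
Qed.

(** The parameters c, tau and, below, gam name the moments: - c is the
    covariance of two places, tau and gam are the mean products over three and
    four distinct places.  They are given by equations, not quotients, since
    for k = 3 the coefficient K - 3 vanishes and gam is free. *)
Variables (c tau : R).
Hypothesis hc : (K - 1) * c = q.
Hypothesis htau : (K - 2) * tau = 2 * r * c.

Let K1 : 0 < K - 1. Proof. by rewrite subr_gt0 ltr1n (leq_trans _ k3). Qed.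
Let K2 : 0 < K - 2. Proof. by rewrite subr_gt0 ltr_nat. Qed.

Lemma mean_val w : mean (fun f : T => a (f w)) = 0.
Proof.
have := @mean_exchange (fun=> 1) [::] w isT isT (fun _ _ _ => erefl).
rewrite big_nil oppr0 addr0 => /eqP; rewrite mulf_eq0 pnatr_eq0.
rewrite -leqn0 leqNgt (leq_trans _ k3) //= => /eqP <-.
by apply: eq_mean => f; rewrite mul1r.
Qed.

Lemma mean_sqr w : mean (fun f : T => a (f w) ^+ 2) = q.
Proof.
rewrite (eq_mean (G := fun f : T => r * a (f w) + q)) //.
by rewrite meanD meanZ mean_val mulr0 add0r mean_cst.
Qed.

Lemma mean_11 u w : u != w -> mean (fun f : T => a (f u) * a (f w)) = - c.
Proof.
move=> uw; apply: (mulfI (lt0r_neq0 K1)).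
rewrite -[1]/(1%:R).
rewrite (@mean_exchange (fun f => a (f u)) [:: u] w) //=; last 2 first.
- by rewrite inE eq_sym.
- move=> w' f; rewrite inE => w'u; rewrite permM tpermD // eq_sym //.
rewrite big_seq1 mulrN hc; congr (- _).
by rewrite -[RHS](mean_sqr u); apply: eq_mean => f; rewrite expr2.
Qed.

Lemma mean_21 u w : u != w ->
  mean (fun f : T => a (f u) ^+ 2 * a (f w)) = - r * c.
Proof.
move=> uw.
rewrite (eq_mean (G := fun f : T => r * (a (f u) * a (f w)) + q * a (f w))).
  by rewrite meanD !meanZ mean_11 // mean_val; ring.
by move=> f; rewrite a2; ring.
Qed.

Lemma mean_111 u v w : uniq [:: u; v; w] ->
  mean (fun f : T => a (f u) * a (f v) * a (f w)) = tau.
Proof.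
move=> uvw; apply: (mulfI (lt0r_neq0 K2)).
have [uv uw vw] : [/\ u != v, u != w & v != w].
  by move: uvw; rewrite /= !inE negb_or andbT => /andP[/andP[]].
rewrite -[2]/(2%:R).
rewrite (@mean_exchange (fun f => a (f u) * a (f v)) [:: u; v] w) //=.
- rewrite big_cons big_seq1 htau.
  rewrite (eq_mean (G := fun f : T => a (f u) ^+ 2 * a (f v))); last first.
    by move=> f; ring.
  rewrite [in X in _ + X](eq_mean (G := fun f : T => a (f v) ^+ 2 * a (f u))).
    by rewrite !mean_21 // 1?eq_sym //; ring.
  by move=> f; ring.
- by rewrite inE uv.
- by rewrite !inE negb_or eq_sym uw eq_sym.
- move=> w' f; rewrite !inE negb_or => /andP[w'u w'v].
  by rewrite !permM !tpermD // eq_sym.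
Qed.

Lemma mean_22 u w : u != w ->
  mean (fun f : T => a (f u) ^+ 2 * a (f w) ^+ 2) = q ^+ 2 - r ^+ 2 * c.
Proof.
move=> uw.
rewrite (eq_mean (G := fun f : T => r ^+ 2 * (a (f u) * a (f w)) +
   (q * r * a (f u) + q * r * a (f w) + q ^+ 2))).
  by rewrite !meanD !meanZ mean_11 // !mean_val mean_cst //; ring.
by move=> f; rewrite !a2; ring.
Qed.

Lemma mean_211 u v w : uniq [:: u; v; w] ->
  mean (fun f : T => a (f u) ^+ 2 * a (f v) * a (f w)) = r * tau - q * c.
Proof.
move=> uvw.
have vw : v != w by move: uvw; rewrite /= !inE; case/and3P.
rewrite (eq_mean (G := fun f : T => r * (a (f u) * a (f v) * a (f w)) +
   q * (a (f v) * a (f w)))).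
  by rewrite !meanD !meanZ mean_11 // mean_111 //; ring.
by move=> f; rewrite !a2; ring.
Qed.

Variable gam : R.
Let alp := q ^+ 2 - r ^+ 2 * c.
Let bet := r * tau - q * c.
Hypothesis hgam : (K - 3) * gam = - 3 * bet.

(** Four distinct places exist only for k > 3, where gam is determined. *)
Lemma mean_1111 u v w x : uniq [:: u; v; w; x] ->
  mean (fun f : T => a (f u) * a (f v) * a (f w) * a (f x)) = gam.
Proof.
move=> uvwx.
have k4 : (4 <= k)%N.
  by rewrite -[k]card_ord; apply: leq_trans (max_card (mem [:: u; v; w; x]));
     rewrite (card_uniqP uvwx).
have K3 : K - 3 != 0 by rewrite subr_eq0 eqr_nat gtn_eqF.
apply: (mulfI K3); rewrite hgam.
have [uvw xu] : uniq [:: u; v; w] /\ x \notin [:: u; v; w].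
  by move: uvwx; rewrite -[[:: u; v; w; x]]/(rcons [:: u; v; w] x) rcons_uniq;
     case/andP.
have [uv uw vw] : [/\ u != v, u != w & v != w].
  by move: uvw; rewrite /= !inE negb_or andbT => /andP[/andP[]].
rewrite -[3]/(3%:R) (@mean_exchange (fun f => a (f u) * a (f v) * a (f w))
  [:: u; v; w] x) //=.
- rewrite !big_cons big_nil addr0.
  rewrite (eq_mean
    (G := fun f : T => a (f u) ^+ 2 * a (f v) * a (f w))); last first.
    by move=> f; ring.
  rewrite [in X in _ + (X + _)](eq_mean
    (G := fun f : T => a (f v) ^+ 2 * a (f u) * a (f w))); last first.
    by move=> f; ring.
  rewrite [in X in _ + (_ + X)](eq_mean
    (G := fun f : T => a (f w) ^+ 2 * a (f u) * a (f v))); last first.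
    by move=> f; ring.
  rewrite !mean_211 ?/bet; first ring;
  by rewrite /= !inE ?negb_or ?uv ?uw ?vw 1?eq_sym ?uv ?uw ?vw
    1?eq_sym ?uv ?uw ?vw.
- move=> w' f; rewrite !inE => w'u; move: xu; rewrite !inE.
  move: w'u; rewrite !negb_or => /and3P[? ? ?] /and3P[? ? ?].
  by rewrite !permM !tpermD // eq_sym.
Qed.

(** The mean product over two pairs uv and wx depends only on whether they are
    equal, adjacent or disjoint; writing it as a polynomial in the four
    incidences makes it summable over all pairs of edges. *)
Lemma mean_pairs u v w x : u != v -> w != x ->
  mean (fun f : T => a (f u) * a (f v) * (a (f w) * a (f x))) =
  gam + (bet - gam) * ((u == w)%:R + (u == x)%:R + (v == w)%:R + (v == x)%:R)
  + (alp - 2 * bet + gam) *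
    ((u == w)%:R * (v == x)%:R + (u == x)%:R * (v == w)%:R).
Proof.
move=> uv wx.
have vu : v != u by rewrite eq_sym.
have xw : x != w by rewrite eq_sym.
have h2 (y z t : 'I_k) (F : T -> R) : uniq [:: y; z; t] ->
    (forall f, F f = a (f y) ^+ 2 * a (f z) * a (f t)) -> mean F = bet.
  by move=> yzt FE; rewrite (eq_mean FE) mean_211.
have h3 (y z : 'I_k) (F : T -> R) : y != z ->
    (forall f, F f = a (f y) ^+ 2 * a (f z) ^+ 2) -> mean F = alp.
  by move=> yz FE; rewrite (eq_mean FE) mean_22.
have [ux|ux] := eqVneq u x.
  subst x; rewrite (negbTE vu) (negbTE xw).
  have [vw|vw] := eqVneq v w => /=; rewrite ?mulr0n ?mulr1n.
    by subst w; rewrite (h3 u v) //; [ring | move=> f; ring].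
  rewrite (h2 u v w); [ring | | by move=> f; ring].
  by rewrite /= !inE negb_or uv xw vw.
have [uw|uw] := eqVneq u w.
  subst w; rewrite (negbTE vu).
  have [vx|vx] := eqVneq v x => /=; rewrite ?mulr0n ?mulr1n.
    by subst x; rewrite (h3 u v) //; [ring | move=> f; ring].
  rewrite (h2 u v x); [ring | | by move=> f; ring].
  by rewrite /= !inE negb_or uv ux vx.
have [vx|vx] := eqVneq v x.
  subst x; rewrite (negbTE xw) /= ?mulr0n ?mulr1n.
  rewrite (h2 v u w); [ring | | by move=> f; ring].
  by rewrite /= !inE negb_or vu uw xw.
have [vw|vw] := eqVneq v w => /=; rewrite ?mulr0n ?mulr1n.
  subst w; rewrite (h2 v u x); [ring | | by move=> f; ring].
  by rewrite /= !inE negb_or vu ux vx.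
rewrite (eq_mean (G := fun f : T => a (f u) * a (f v) * a (f w) * a (f x))).
  rewrite mean_1111; first by ring.
  by rewrite /= !inE !negb_or uv uw ux vw vx wx.
by move=> f; ring.
Qed.

Lemma mean_linear_sqr (b : 'I_k -> R) :
  mean (fun f : T => (\sum_i b i * a (f i)) ^+ 2) =
  (q + c) * (\sum_i b i ^+ 2) - c * (\sum_i b i) ^+ 2.
Proof.
transitivity (\sum_i \sum_j b i * b j * ((q + c) * (i == j)%:R - c)).
  transitivity (mean (fun f : T =>
      \sum_i \sum_j b i * b j * (a (f i) * a (f j)))).
    apply: eq_mean => f; rewrite expr2 mulr_suml; apply: eq_bigr => i _.
    by rewrite mulr_sumr; apply: eq_bigr => j _; ring.
  rewrite mean_sum; apply: eq_bigr => i _; rewrite mean_sum.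
  apply: eq_bigr => j _; rewrite meanZ; congr (_ * _).
  have [<-|ij] := eqVneq i j; last by rewrite mean_11 // mulr0n; ring.
  rewrite mulr1n mulr1 addrK -[RHS](mean_sqr i).
  by apply: eq_mean => f; rewrite expr2.
rewrite !mulr_sumr expr2 mulr_suml mulr_sumr -sumrB; apply: eq_bigr => i _.
rewrite (eq_bigr
  (fun j => (q + c) * b i * (b j * (i == j)%:R) - c * b i * b j)).
  rewrite sumrB -!mulr_sumr (bigD1 i) //= eqxx mulr1 big1 ?addr0; first by ring.
  by move=> j ji; rewrite eq_sym (negbTE ji) mulr0.
by move=> j _; ring.
Qed.

End Moments.

Section BlockQuadratic.
Variables (R : rcfType) (k : nat) (a : 'I_k -> R) (q r c tau gam : R).
Let K : R := k%:R.
Hypothesis k3 : (3 <= k)%N.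
Hypothesis a2 : forall z, a z ^+ 2 = r * a z + q.
Hypothesis a0 : \sum_z a z = 0.
Hypothesis hc : (K - 1) * c = q.
Hypothesis htau : (K - 2) * tau = 2 * r * c.
Let alp := q ^+ 2 - r ^+ 2 * c.
Let bet := r * tau - q * c.
Hypothesis hgam : (K - 3) * gam = - 3 * bet.
Variable e : rel 'I_k.
Hypotheses (e_sym : symmetric e) (e_irr : irreflexive e).
Let M u v : R := (e u v)%:R.
Let d u := \sum_v M u v.
Let S := \sum_u d u.

Let Msym u v : M u v = M v u. Proof. by rewrite /M e_sym. Qed.
Let Mn u v : M u v != 0 -> u != v.
Proof.
by rewrite /M pnatr_eq0 eqb0 negbK; apply: contraTneq => ->; rewrite e_irr.
Qed.

Lemma mean_quad :
  mean (fun f : 'S_k => \sum_u \sum_v M u v * (a (f u) * a (f v))) = - c * S.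
Proof.
rewrite mean_sum mulr_sumr; apply: eq_bigr => u _.
rewrite mean_sum mulr_sumr; apply: eq_bigr => v _; rewrite meanZ.
have [->|/Mn uv] := eqVneq (M u v) 0; first by rewrite mul0r mulr0.
by rewrite (mean_11 k3 a2 a0 hc) // mulrC.
Qed.

(** With S twice the number of edges, the three terms come from all pairs of
    edges, from adjacent pairs and from equal pairs. *)
Lemma mean_quad_sqr :
  mean (fun f : 'S_k =>
    (\sum_u \sum_v M u v * (a (f u) * a (f v))) ^+ 2) =
  gam * S ^+ 2 + 4 * (bet - gam) * (\sum_u d u ^+ 2)
    + 2 * (alp - 2 * bet + gam) * S.
Proof.
set kap := alp - 2 * bet + gam; set del := bet - gam.
pose I f := \sum_u \sum_v M u v * (a ((f : 'S_k) u) * a (f v)).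
have dirac (F : 'I_k -> R) u : \sum_w (u == w)%:R * F w = F u.
  rewrite (bigD1 u) //= eqxx mul1r big1 ?addr0 // => w wu.
  by rewrite eq_sym (negbTE wu) mul0r.
have colsum u : \sum_w M w u = d u.
  by apply: eq_bigr => w _; rewrite Msym.
have step u v : u != v -> mean (fun f : 'S_k => a (f u) * a (f v) * I f) =
    gam * S + del * (2 * d u + 2 * d v) + 2 * kap * M u v.
  move=> uv; transitivity (\sum_w \sum_x M w x *
     (gam + del * ((u == w)%:R + (u == x)%:R + (v == w)%:R + (v == x)%:R)
  + kap * ((u == w)%:R * (v == x)%:R + (u == x)%:R * (v == w)%:R))).
    rewrite (eq_mean (G := fun f : 'S_k => \sum_w \sum_x M w x *
      (a (f u) * a (f v) * (a (f w) * a (f x))))).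
      rewrite mean_sum; apply: eq_bigr => w _.
      rewrite mean_sum; apply: eq_bigr => x _; rewrite meanZ.
      have [->|/Mn wx] := eqVneq (M w x) 0; first by rewrite !mul0r.
      by rewrite (mean_pairs k3 a2 a0 hc htau hgam).
    move=> f; rewrite /I mulr_sumr; apply: eq_bigr => w _; rewrite mulr_sumr.
    by apply: eq_bigr => x _; ring.
  have inner w : \sum_x M w x *
     (gam + del * ((u == w)%:R + (u == x)%:R + (v == w)%:R + (v == x)%:R)
  + kap * ((u == w)%:R * (v == x)%:R + (u == x)%:R * (v == w)%:R)) =
    gam * d w + del * (M w u + M w v) + (u == w)%:R * (del * d w + kap * M w v)
     + (v == w)%:R * (del * d w + kap * M w u).
    rewrite -(dirac (M w) u) -(dirac (M w) v) /d !mulrDr !mulr_sumr.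
    rewrite -!big_split /=.
    by apply: eq_bigr => x _; ring.
  rewrite (eq_bigr _ (fun w _ => inner w)) !big_split /= !dirac -!mulr_sumr.
  rewrite big_split /= -/S.
  rewrite !colsum (Msym v u); ring.
rewrite (eq_mean (G := fun f : 'S_k =>
  \sum_u \sum_v M u v * (a (f u) * a (f v) * I f))).
  transitivity (\sum_u \sum_v
    M u v * (gam * S + 2 * del * d u + 2 * del * d v + 2 * kap)).
    rewrite mean_sum; apply: eq_bigr => u _.
    rewrite mean_sum; apply: eq_bigr => v _.
    rewrite meanZ; have [->|Muv] := eqVneq (M u v) 0; first by rewrite !mul0r.
    rewrite step ?Mn //; congr (_ * _).
    have -> : M u v = 1 by move: Muv; rewrite /M pnatr_eq0 eqb0 negbK => ->.
    by ring.
  transitivity (\sum_u ((gam * S + 2 * kap) * d u + 2 * del * d u ^+ 2)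
     + \sum_v \sum_u 2 * del * d v * M u v).
    rewrite [X in _ = _ + X]exchange_big -big_split /=; apply: eq_bigr => u _.
    have -> : (gam * S + 2 * kap) * d u + 2 * del * d u ^+ 2 =
        (gam * S + 2 * kap + 2 * del * d u) * \sum_v M u v.
      by rewrite -/(d u); ring.
    rewrite [X in _ = X + _]mulr_sumr -big_split /=.
    by apply: eq_bigr => v _; ring.
  have -> : \sum_v \sum_u 2 * del * d v * M u v = 2 * del * \sum_u d u ^+ 2.
    rewrite mulr_sumr; apply: eq_bigr => v _; rewrite -mulr_sumr expr2 mulrA.
    by congr (_ * _); apply: eq_bigr => u _; rewrite Msym.
  by rewrite big_split /= -!mulr_sumr -/S; ring.
move=> f; rewrite expr2 mulr_suml; apply: eq_bigr => u _; rewrite mulr_suml.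
by apply: eq_bigr => v _; rewrite /I; ring.
Qed.

End BlockQuadratic.

(** * Counting edges and degrees *)

Section CountEdges.
Variables (V : finType) (adj : rel V).
Hypotheses (adj_sym : symmetric adj) (adj_irr : irreflexive adj).

(** An edge is the image of exactly two ordered pairs; this is where
    irreflexivity enters. *)
Lemma card_darts (S : {set V}) :
  #|[set p : V * V | [&& adj p.1 p.2, p.1 \in S & p.2 \in S]]| =
  (2 * edges_within adj S)%N.
Proof.
set D := [set p | _]; pose g (p : V * V) := [set p.1; p.2].
have -> : edges_within adj S = #|g @: D|.
  congr #|pred_of_set _|; apply/setP => E; rewrite inE.
  apply/andP/imsetP => [[/imsetP[p pe ->] sub]|[p]].
    rewrite inE in pe; exists p => //; rewrite inE pe /=.
    by move: sub; rewrite subUset !sub1set.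
  rewrite inE => /and3P[pe p1 p2] ->; split.
    by apply/imsetP; exists p; rewrite ?inE.
  by rewrite subUset !sub1set p1.
rewrite -sum1_card (partition_big_imset g) /= mulnC -sum_nat_const.
apply: eq_bigr => E /imsetP[[u v]]; rewrite inE /= => /and3P[uv uS vS] ->.
have neq : u != v by apply: contraTneq uv => ->; rewrite adj_irr.
transitivity #|[set (u, v); (v, u)]|; last first.
  by rewrite cards2 xpair_eqE negb_and neq.
rewrite sum1_card.
apply: eq_card => -[x y]; rewrite unfold_in !inE /= /g /= !xpair_eqE.
apply/andP/idP => [[/and3P[xy xS yS] /eqP Eq]|].
  have xyn : x != y by apply: contraTneq xy => ->; rewrite adj_irr.
  have : x \in [set u; v] by rewrite -Eq !inE eqxx.
  have : y \in [set u; v] by rewrite -Eq !inE eqxx orbT.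
  rewrite !inE => /orP[] /eqP ye /orP[] /eqP xe; subst x y;
    rewrite ?eqxx ?orbT // in xyn *.
case/orP => /andP[/eqP -> /eqP ->]; rewrite ?uv ?uS ?vS /=.
  by [].
by rewrite adj_sym uv setUC.
Qed.

End CountEdges.

Lemma sum_darts (R : rcfType) (V : finType) (adj : rel V) (S : {set V}) :
  symmetric adj -> irreflexive adj ->
  \sum_u \sum_v (adj u v)%:R * ((u \in S)%:R * (v \in S)%:R) =
  2 * (edges_within adj S)%:R :> R.
Proof.
move=> sy ir; rewrite -natrM -card_darts // -sum1_card natr_sum pair_big /=.
rewrite big_mkcond [RHS]big_mkcond /=; apply: eq_bigr => -[u v] _ /=.
by rewrite inE /= -!natrM !mulnb; case: ifP.
Qed.

Lemma edges_within_setT (V : finType) (adj : rel V) :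
  edges_within adj [set: V] = #|edges adj|.
Proof. by apply: eq_card => E; rewrite !inE subsetT andbT. Qed.

Section DegreeSums.
Variables (R : rcfType) (V : finType) (e : rel V).
Hypotheses (V0 : (0 < #|V|)%N) (e_sym : symmetric e).
Let K : R := #|V|%:R.
Let M u v : R := (e u v)%:R.
Let d u := \sum_v M u v.
Let S := \sum_u d u.

Let Msym u v : M u v = M v u. Proof. by rewrite /M e_sym. Qed.

Lemma sum_sqr_deg_ge : S <= \sum_u d u ^+ 2.
Proof.
apply: ler_sum => u _; rewrite /d /M -natr_sum -natrX ler_nat.
by case: (\sum_i _)%N => // n; rewrite expnS leq_pmulr // expn_gt0.
Qed.

Lemma sum_sqr_deg_cauchy : S ^+ 2 / K <= \sum_u d u ^+ 2.
Proof.
have K0 : 0 < K by rewrite ltr0n.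
have : 0 <= \sum_u (d u - S / K) ^+ 2 by apply: sumr_ge0 => u _; apply: sqr_ge0.
rewrite (eq_bigr
  (fun u => d u ^+ 2 - 2 * (S / K) * d u + (S / K) ^+ 2)); last first.
  by move=> u _; ring.
rewrite big_split sumrB /= -mulr_sumr -/S sumr_const.
rewrite -[_ *+ #|V|]mulr_natl -/K.
have -> : K * (S / K) ^+ 2 = S ^+ 2 / K by field; rewrite lt0r_neq0.
have -> : 2 * (S / K) * S = 2 * (S ^+ 2 / K) by ring.
by lra.
Qed.

(** A weak form of de Caen's inequality on sums of squares of degrees: expand
    the squared distance of the adjacency matrix from the matrix with entries
    (d u + d v) / K. *)
Lemma sum_sqr_deg_le : \sum_u d u ^+ 2 <= K * S / 2 + S ^+ 2 / K.
Proof.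
have K0 : 0 < K by rewrite ltr0n.
set D := \sum_u _.
have : 0 <= \sum_u \sum_v (M u v - (d u + d v) / K) ^+ 2.
  by apply: sumr_ge0 => u _; apply: sumr_ge0 => v _; apply: sqr_ge0.
have -> : \sum_u \sum_v (M u v - (d u + d v) / K) ^+ 2 =
    \sum_u (d u - 2 / K * d u ^+ 2 + K * (d u ^+ 2 / K ^+ 2)
            + 2 / K ^+ 2 * S * d u)
    + \sum_v (- (2 / K) * d v ^+ 2 + K * (d v ^+ 2 / K ^+ 2)).
  have -> : \sum_v (- (2 / K) * d v ^+ 2 + K * (d v ^+ 2 / K ^+ 2)) =
    \sum_v \sum_u (- (2 / K) * d v * M u v + d v ^+ 2 / K ^+ 2).
    apply: eq_bigr => v _; rewrite big_split sumr_const.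
    rewrite -[_ *+ #|V|]mulr_natl -mulr_sumr /=.
    rewrite (eq_bigr (M v)); last by move=> u _; rewrite Msym.
    by rewrite -/(d v) -/K; ring.
  rewrite [X in _ = _ + X]exchange_big -big_split /=; apply: eq_bigr => u _.
  transitivity (\sum_v (M u v - 2 / K * d u * M u v + d u ^+ 2 / K ^+ 2
      + 2 / K ^+ 2 * d u * d v
      + (- (2 / K) * d v * M u v + d v ^+ 2 / K ^+ 2))).
    apply: eq_bigr => v _.
    have -> : (M u v - (d u + d v) / K) ^+ 2 =
        M u v ^+ 2 - 2 * M u v * (d u + d v) / K + (d u + d v) ^+ 2 / K ^+ 2.
      by field; rewrite lt0r_neq0.
    have -> : M u v ^+ 2 = M u v by rewrite /M -natrX; case: (e u v).
    by field; rewrite lt0r_neq0.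
  rewrite !big_split /= sumrN sumr_const -!mulr_sumr -/(d u) -/S.
  rewrite -[_ *+ #|V|]mulr_natl -/K.
  by ring.
rewrite !big_split /= sumrN -!mulr_sumr -!mulr_suml -/S -/D.
have -> : S - 2 / K * D + K * (D / K ^+ 2) + 2 / K ^+ 2 * S * S +
   (- (2 / K) * D + K * (D / K ^+ 2)) = 2 / K * (K * S / 2 + S ^+ 2 / K - D).
  by field; rewrite lt0r_neq0.
by rewrite pmulr_rge0 ?subr_ge0 // divr_gt0.
Qed.

End DegreeSums.

(** * The quadratic term of a single block *)

(** The two inequalities below are the numerical heart of the estimate inside a
    block.  There K = k, x = l (k - l), h is the number of edges in the block
    and D the sum of the squares of their degrees; the left-hand side is the
    variance of the block's quadratic term, as computed from [mean_quad_sqr].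

    In the eigenspace language of the Johnson scheme this variance is a
    combination of the squared norms of two components of the edge set, with
    coefficients lambda1 and lambda2.  For l = 1 or l = k - 1 the second one is
    0, and an upper bound on D suffices. *)
Lemma block_bound_extreme (R : rcfType) (K h D x : R) :
  3 <= K -> x = K - 1 -> D <= K * h + 4 * h ^+ 2 / K ->
  let q := x / K ^+ 2 in
  let c := q / (K - 1) in
  let alp := q ^+ 2 - (1 - 4 * q) * c in
  let bet := 2 * (1 - 4 * q) * c / (K - 2) - q * c in
  let gam := - 3 / K ^+ 4 in
  (K - 3) * gam = - 3 * bet /\
  gam * h ^+ 2 + (bet - gam) * D + (alp - 2 * bet + gam) * h - c ^+ 2 * h ^+ 2
    <= (x / (K * (K - 1))) ^+ 2 * h.
Proof.
move=> K3 -> HD q c alp bet gam.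
have K0 : K != 0 by apply: lt0r_neq0; lra.
have K1 : K - 1 != 0 by apply: lt0r_neq0; lra.
have K2 : K - 2 != 0 by apply: lt0r_neq0; lra.
have Kp : 0 < K by lra.
split; first by rewrite /gam /bet /c /q; field; rewrite ?K0 ?K1 ?K2.
have -> : gam * h ^+ 2 + (bet - gam) * D + (alp - 2 * bet + gam) * h
   - c ^+ 2 * h ^+ 2 = (K ^- 3) * (D - 4 * h ^+ 2 / K).
  by rewrite /gam /bet /alp /c /q; field; rewrite ?K0 ?K1 ?K2.
have -> : ((K - 1) / (K * (K - 1))) ^+ 2 * h = K ^- 3 * (K * h).
  by field; rewrite ?K0 ?K1.
by rewrite ler_pM2l ?invr_gt0 ?exprn_gt0 // lerBlDr.
Qed.

(** For 2 <= l <= k - 2 the coefficient bet - gam of D is nonpositive, so a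
    lower bound on D is needed.  If h = 1, D >= 2 reduces the variance to
    alp - c ^ 2 <= q ^ 2.  If h >= 2, the Cauchy-Schwarz bound on D leaves
    kap (1 - 2 h / (K (K - 1))) h, where kap = lambda2 may exceed s ^ 2
    and the factor in brackets compensates for it; this is sharp for
    K = 4, x = 4, h = 2. *)
Lemma block_bound_middle (R : rcfType) (K h D x : R) :
  4 <= K -> 2 * (K - 2) <= x -> 4 * x <= K ^+ 2 ->
  (h = 0) \/ (h = 1) \/ (2 <= h) ->
  2 * h <= D -> 4 * h ^+ 2 / K <= D ->
  let q := x / K ^+ 2 in
  let c := q / (K - 1) in
  let alp := q ^+ 2 - (1 - 4 * q) * c in
  let bet := 2 * (1 - 4 * q) * c / (K - 2) - q * c in
  let gam := - 3 * bet / (K - 3) in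
  (K - 3) * gam = - 3 * bet /\
  gam * h ^+ 2 + (bet - gam) * D + (alp - 2 * bet + gam) * h - c ^+ 2 * h ^+ 2
    <= (x / (K * (K - 1))) ^+ 2 * h.
Proof.
move=> K4 x2 x4 hh D2 D4 q c alp bet gam.
have K0 : K != 0 by apply: lt0r_neq0; lra.
have K1 : K - 1 != 0 by apply: lt0r_neq0; lra.
have K2 : K - 2 != 0 by apply: lt0r_neq0; lra.
have K3 : K - 3 != 0 by apply: lt0r_neq0; lra.
have pK0 : 0 < K by lra.
have pK1 : 0 < K - 1 by lra.
have pK2 : 0 < K - 2 by lra.
have pK3 : 0 < K - 3 by lra.
have x0 : 0 < x by lra.
split; first by rewrite /gam; field.
have q0 : 0 < q by rewrite divr_gt0 ?exprn_gt0.
have q4 : 4 * q <= 1.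
  by rewrite /q mulrA ler_pdivrMr ?exprn_gt0 // mul1r.
have c0 : 0 < c by rewrite divr_gt0.
set s := x / (K * (K - 1)).
have qs : q <= s.
  have -> : s = q * (K / (K - 1)).
    by rewrite /s /q; field; rewrite ?K0 ?K1 ?K2 ?K3.
  by rewrite ler_peMr ?(ltW q0) // ler_pdivlMr // mul1r; lra.
have del0 : bet - gam <= 0.
  have -> : bet - gam = - (c * K / ((K - 2) * (K - 3))) *
       ((x * (K + 6) - 2 * K ^+ 2) / K ^+ 2).
    by rewrite /gam /bet /c /q; field; rewrite ?K0 ?K1 ?K2 ?K3.
  rewrite mulNr oppr_le0; apply: mulr_ge0; apply: divr_ge0.
  - by rewrite ltW // mulr_gt0.
  - by rewrite ltW // mulr_gt0.
  - nra.
  - exact: sqr_ge0.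
case: hh D2 D4 => [->|[->|h2]].
- move=> D20 _; rewrite expr0n /= !mulr0 subr0 addr0 add0r.
  by rewrite mulr_le0_ge0 // -[0](mulr0 2).
- move=> D2 _; apply: le_trans (_ : q ^+ 2 <= _); last first.
    by rewrite mulr1 lerXn2r ?nnegrE //; lra.
  apply: le_trans (_ : alp - c ^+ 2 <= _).
    rewrite expr1n !mulr1; nra.
  have : 0 <= (1 - 4 * q) * c by apply: mulr_ge0; lra.
  rewrite /alp; nra.
move=> _ D4; set kap := alp - 2 * bet + gam.
have kapE : kap = x * (x - K + 1) / (K * (K - 1) * (K - 2) * (K - 3)).
  by rewrite /kap /alp /gam /bet /c /q; field; rewrite ?K0 ?K1 ?K2 ?K3.
have E : gam * h ^+ 2 + (bet - gam) * D + kap * h - c ^+ 2 * h ^+ 2 =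
  kap * (1 - 2 * h / (K * (K - 1))) * h + (bet - gam) * (D - 4 * h ^+ 2 / K).
  by rewrite /kap /alp /gam /bet /c /q; field; rewrite ?K0 ?K1 ?K2 ?K3.
rewrite E.
have kap0 : 0 <= kap.
  rewrite kapE; apply: divr_ge0; last by rewrite ltW // !mulr_gt0.
  by apply: mulr_ge0; lra.
have t1 : (bet - gam) * (D - 4 * h ^+ 2 / K) <= 0.
  by rewrite mulr_le0_ge0 // subr_ge0.
have t2 : kap * (1 - 4 / (K * (K - 1))) <= s ^+ 2.
  have -> : kap * (1 - 4 / (K * (K - 1))) =
      s ^+ 2 - x * ((K - 1) * (K ^+ 2 - K - 4) - x * (4 * K - 10))
               / (K ^+ 2 * (K - 1) ^+ 2 * (K - 2) * (K - 3)).
    by rewrite kapE /s; field; rewrite ?K0 ?K1 ?K2 ?K3.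
  rewrite lerBlDr lerDl; apply: divr_ge0; last first.
    by rewrite ltW // !mulr_gt0 ?exprn_gt0.
  apply: mulr_ge0; first exact: ltW.
  have h1 : x * (4 * K - 10) * 4 <= K ^+ 2 * (4 * K - 10) by nra.
  have h2' : 0 <= (K - 2) * (K - 4) by apply: mulr_ge0; lra.
  nra.
have t3 : kap * (1 - 2 * h / (K * (K - 1))) <= s ^+ 2.
  apply: le_trans t2; rewrite ler_wpM2l // lerD2l lerN2.
  by rewrite ler_pM2r ?invr_gt0 ?mulr_gt0 //; lra.
have : kap * (1 - 2 * h / (K * (K - 1))) * h <= s ^+ 2 * h.
  by rewrite ler_wpM2r //; lra.
lra.
Qed.

Section Centred.
Variables (R : rcfType) (k l : nat) (A : {set 'I_k}).
Hypotheses (k3 : (3 <= k)%N) (hl : (1 <= l <= k - 1)%N) (cardA : #|A| = l).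
Let K : R := k%:R.
Let L : R := l%:R.

Definition centred_ind (z : 'I_k) : R := (z \in A)%:R - L / K.

Let q : R := L * (K - L) / K ^+ 2.
Let c : R := q / (K - 1).
Let s : R := L * (K - L) / (K * (K - 1)).
Let r : R := 1 - 2 * (L / K).
Let tau : R := 2 * r * c / (K - 2).

Let K3 : 3 <= K. Proof. by rewrite ler_nat. Qed.
Let L1 : 1 <= L. Proof. by case/andP: hl => ? _; rewrite ler1n. Qed.
Let LK : L + 1 <= K.
Proof. by case/andP: hl => ? ?; rewrite natr1 ler_nat; lia. Qed.
Let K0 : K != 0. Proof. by apply: lt0r_neq0; move: K3 => ?; lra. Qed.
Let K1 : K - 1 != 0. Proof. by apply: lt0r_neq0; move: K3 => ?; lra. Qed.
Let K2 : K - 2 != 0. Proof. by apply: lt0r_neq0; move: K3 => ?; lra. Qed.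
Let x0 : 0 < L * (K - L).
Proof. by move: L1 LK => ? ?; apply: mulr_gt0; lra. Qed.

Lemma centred_ind_sqr z : centred_ind z ^+ 2 = r * centred_ind z + q.
Proof.
rewrite /centred_ind /r /q.
by case: (z \in A); rewrite /= ?mulr0n ?mulr1n; field.
Qed.

Lemma sum_centred_ind : \sum_z centred_ind z = 0.
Proof.
rewrite sumrB -natr_sum sumr_const card_ord -[_ *+ k]mulr_natl -/K mulrCA.
rewrite divff // mulr1 (_ : (\sum_i (i \in A))%N = l) ?subrr //.
rewrite -cardA -sum1_card [RHS]big_mkcond /=.
by apply: eq_bigr => i _; case: (i \in A).
Qed.

Let hc : (K - 1) * c = q. Proof. by rewrite /c mulrCA divff // mulr1. Qed.
Let htau : (K - 2) * tau = 2 * r * c.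
Proof. by rewrite /tau mulrCA divff // mulr1. Qed.

Lemma mean_centred (z : 'I_k) : mean (fun f : 'S_k => centred_ind (f z)) = 0.
Proof. exact: (mean_val k3 sum_centred_ind). Qed.

(** The covariance matrix of the random vector is s times an orthogonal
    projection, the one onto the vectors of sum 0. *)
Lemma mean_linear_sqr_le (w : 'I_k -> R) :
  mean (fun f : 'S_k => (\sum_i w i * centred_ind (f i)) ^+ 2) <=
  s * \sum_i w i ^+ 2.
Proof.
rewrite (mean_linear_sqr k3 centred_ind_sqr sum_centred_ind hc).
have -> : q + c = s by rewrite /c /s /q; field; rewrite ?K0 ?K1.
rewrite lerBlDr lerDl; apply: mulr_ge0; last exact: sqr_ge0.
have [K3' x0'] := (K3, x0).
apply/ltW/divr_gt0; last by lra.
by apply: divr_gt0 => //; apply: exprn_gt0; lra.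
Qed.

Variable e : rel 'I_k.
Hypotheses (e_sym : symmetric e) (e_irr : irreflexive e).
Let M u v : R := (e u v)%:R.
Let I (f : 'S_k) :=
  \sum_u \sum_v M u v * (centred_ind (f u) * centred_ind (f v)).
Let S := \sum_u \sum_v M u v.

Lemma mean_block : mean (fun f => I f / 2 + c * (S / 2)) = 0.
Proof.
rewrite meanD meanZr mean_cst; last by apply/card_gt0P; exists 1%g.
rewrite (mean_quad k3 centred_ind_sqr sum_centred_ind hc e_irr) -/S.
by field.
Qed.

(** The estimate for edges inside one block.  For k > 3 the fourth moment gam is
    - 3 bet / (K - 3), which for l = 1 and l = k - 1 equals - 3 / K ^ 4; this
    second form also serves k = 3, where l can only be 1 or k - 1. *)
Lemma mean_block_sqr_le :
  mean (fun f => (I f / 2 + c * (S / 2)) ^+ 2) <= s ^+ 2 * (S / 2).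
Proof.
have [[[K3' L1'] LK'] x0'] := (K3, L1, LK, x0).
have [k3' hl'] := (k3, hl).
pose h : R := (edges_within e setT)%:R.
have SE : S = 2 * h.
  rewrite -(sum_darts R setT e_sym e_irr); apply: eq_bigr => u _.
  by apply: eq_bigr => v _; rewrite !inE !mulr1.
pose D := \sum_u (\sum_v M u v) ^+ 2.
have D1 := sum_sqr_deg_ge R e; rewrite -/S -/D SE in D1.
have V0 : (0 < #|{: 'I_k}|)%N by rewrite card_ord (leq_trans _ k3).
have D2 := sum_sqr_deg_cauchy R e V0; rewrite card_ord -/S -/D SE in D2.
have D3 := sum_sqr_deg_le R V0 e_sym; rewrite card_ord -/S -/D SE in D3.
have e22 : (2 * h) ^+ 2 = 4 * h ^+ 2 by ring.
rewrite -/K e22 in D2 D3.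
have {}D3 : D <= K * h + 4 * h ^+ 2 / K by move: D3; lra.
pose alp := q ^+ 2 - r ^+ 2 * c.
pose bet := r * tau - q * c.
have r2 : r ^+ 2 = 1 - 4 * q by rewrite /r /q; field.
have betE : bet = 2 * (1 - 4 * q) * c / (K - 2) - q * c.
  by rewrite /bet /tau -r2; ring.
have alpE : alp = q ^+ 2 - (1 - 4 * q) * c by rewrite /alp r2.
suff [gam [hgam main]] : exists gam, (K - 3) * gam = - 3 * bet /\
    gam * h ^+ 2 + (bet - gam) * D + (alp - 2 * bet + gam) * h - c ^+ 2 * h ^+ 2
    <= s ^+ 2 * h.
  have -> : S / 2 = h by rewrite SE; field.
  rewrite (eq_mean
    (G := fun f => 4^-1 * I f ^+ 2 + (c * h * I f + (c * h) ^+ 2))).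
    rewrite !meanD !meanZ mean_cst; last by apply/card_gt0P; exists 1%g.
    rewrite (mean_quad k3 centred_ind_sqr sum_centred_ind hc e_irr) -/S.
    rewrite (mean_quad_sqr k3 centred_ind_sqr sum_centred_ind hc htau hgam
      e_sym e_irr).
    rewrite -/S -/D -/alp -/bet SE.
    apply: le_trans main; rewrite le_eqVlt; apply/orP; left.
    by apply/eqP; field.
  by move=> f; field.
have [xE|xge] : L * (K - L) = K - 1 \/ 4 <= K /\ 2 * (K - 2) <= L * (K - L).
  have [l1|l1] := eqVneq l 1%N.
    by left; rewrite /L l1 mul1r.
  have [l2|l2] := eqVneq l (k - 1)%N.
    left; rewrite /L l2 natrB ?(leq_trans _ k3) // -/K; ring.
  right; have l3 : 2 <= L by rewrite ler_nat; lia.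
  have l4 : L + 2 <= K by rewrite -natrD ler_nat; lia.
  split; first by lra.
  have : 0 <= (L - 2) * (K - L - 2) by apply: mulr_ge0; lra.
  by lra.
- have [h1 h2] := block_bound_extreme K3 xE D3.
  by exists (- 3 / K ^+ 4); rewrite alpE betE; split; [exact: h1 | exact: h2].
case: xge => K4 xge.
have [] := @block_bound_middle R K h D (L * (K - L)) K4 xge.
- have : 0 <= (K - 2 * L) ^+ 2 by apply: sqr_ge0.
  by lra.
- rewrite /h; case: (edges_within _ _) => [|[|n]]; [by left|by right; left|].
  by right; right; rewrite ler_nat.
- exact: D1.
- exact: D2.
move=> h1 h2; exists (- 3 * bet / (K - 3)).
by rewrite alpE betE; split; [exact: h1 | exact: h2].
Qed.

End Centred.

(** * Random colourings of a union of blocks *)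

Lemma half_sum_symmetric (R : rcfType) (b : nat) (F : 'I_b -> 'I_b -> R) :
  (forall i j, F i j = F j i) ->
  (\sum_i \sum_j F i j) / 2 =
  \sum_(p : 'I_b * 'I_b | (p.1 <= p.2)%N)
    (if p.1 == p.2 then F p.1 p.2 / 2 else F p.1 p.2).
Proof.
move=> Fsym.
pose Lo := \sum_(p : 'I_b * 'I_b | (p.1 < p.2)%N) F p.1 p.2.
pose Di := \sum_(i < b) F i i.
have E1 : \sum_i \sum_j F i j = Di + Lo + Lo.
  rewrite pair_big /= (bigID (fun p : 'I_b * 'I_b => (p.1 < p.2)%N)) /=.
  rewrite (bigID (fun p : 'I_b * 'I_b => (p.2 < p.1)%N)
    (fun p => ~~ (p.1 < p.2)%N)) /=.
  rewrite -/Lo addrC; congr (_ + _); rewrite addrC; congr (_ + _).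
    rewrite /Di (reindex (fun i : 'I_b => (i, i))) /=.
      by apply: eq_big => i; rewrite ?ltnn.
    exists fst => [i _ //|[i j]]; rewrite inE /= -!leqNgt -eqn_leq.
    by move=> /eqP/val_inj ->.
  rewrite /Lo (reindex_inj (h := fun p : 'I_b * 'I_b => (p.2, p.1))) /=.
    apply: eq_big => [[i j]|[i j] _]; last exact: Fsym.
    by rewrite /=; case: (ltngtP i j).
  by move=> [i j] [i' j'] /= [-> ->].
have E2 : \sum_(p : 'I_b * 'I_b | (p.1 <= p.2)%N)
    (if p.1 == p.2 then F p.1 p.2 / 2 else F p.1 p.2) = Di / 2 + Lo.
  rewrite (bigID (fun p : 'I_b * 'I_b => p.1 == p.2)) /=; congr (_ + _).
    rewrite /Di mulr_suml (reindex (fun i : 'I_b => (i, i))) /=.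
      by apply: eq_big => i; rewrite ?leqnn eqxx.
    by exists fst => [i _ //|[i j]]; rewrite inE /= => /andP[_ /eqP ->].
  apply: eq_big => [[i j]|[i j] /andP[_ /negbTE /= ->] //].
  by rewrite /= ltn_neqAle andbC.
by rewrite E1 E2; field.
Qed.

(** The graph lives on b full blocks of k places; vertices are pairs of a block
    and a place.  The sample space is the set of families of b permutations. *)
Section BlockColouring.
Variables (R : rcfType) (k l b : nat).
Hypotheses (k3 : (3 <= k)%N) (hl : (1 <= l <= k - 1)%N).
Variable e : rel ('I_b * 'I_k).
Hypotheses (e_sym : symmetric e) (e_irr : irreflexive e).
Let K : R := k%:R.
Let L : R := l%:R.
Let c : R := L * (K - L) / K ^+ 2 / (K - 1).
Let s : R := L * (K - L) / (K * (K - 1)).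
Let W := {ffun 'I_b -> 'S_k}.

Definition colour_ind (A : {set 'I_k}) (f : W) (x : 'I_b * 'I_k) : R :=
  centred_ind R l A (f x.1 x.2).

Let adj B B' (i j : 'I_k) : R := (e (B, i) (B', j))%:R.

Let cross A B B' f :=
  \sum_i \sum_j adj B B' i j * (colour_ind A f (B, i) * colour_ind A f (B', j)).

Let nb B B' := \sum_i \sum_j adj B B' i j.

(** The orthogonal pieces, indexed by pairs of blocks p.1 <= p.2; the added
    constant makes the diagonal pieces centred. *)
Let term A (p : 'I_b * 'I_b) f :=
  if p.1 == p.2 then cross A p.1 p.2 f / 2 + c * (nb p.1 p.2 / 2)
  else cross A p.1 p.2 f.

Let adj_sym B B' i j : adj B B' i j = adj B' B j i.
Proof. by rewrite /adj e_sym. Qed.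

Let cross_sym A f B B' : cross A B B' f = cross A B' B f.
Proof.
rewrite /cross exchange_big; apply: eq_bigr => i _; apply: eq_bigr => j _.
by rewrite adj_sym [X in _ * X]mulrC.
Qed.

Let nb_sym B B' : nb B B' = nb B' B.
Proof.
rewrite /nb exchange_big; apply: eq_bigr => i _; apply: eq_bigr => j _.
by rewrite adj_sym.
Qed.

Let perm0 : (0 < #|{: 'S_k}|)%N.
Proof. by apply/card_gt0P; exists 1%g. Qed.

Let pairs_sum (F : ('I_b * 'I_k) -> ('I_b * 'I_k) -> R) :
  \sum_x \sum_y F x y = \sum_B \sum_B' \sum_i \sum_j F (B, i) (B', j).
Proof.
rewrite (eq_bigr (fun x => \sum_B' \sum_j F x (B', j))); last first.
  by move=> x _; rewrite pair_big /=; apply: eq_bigr => -[].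
transitivity (\sum_B \sum_i \sum_B' \sum_j F (B, i) (B', j)).
  by rewrite [RHS]pair_big /=; apply: eq_bigr => -[].
by apply: eq_bigr => B _; rewrite exchange_big.
Qed.

Let term_dep A (p : 'I_b * 'I_b) B f t :
  B \notin [set p.1; p.2] -> term A p (resample f B t) = term A p f.
Proof.
case: p => B1 B2; rewrite !inE negb_or /= => /andP[B1n B2n].
have E : cross A B1 B2 (resample f B t) = cross A B1 B2 f.
  apply: eq_bigr => i _; apply: eq_bigr => j _.
  by rewrite /colour_ind /= !resample_neq // eq_sym.
by rewrite /term /= E.
Qed.

Let scale_ge0 : 0 <= s.
Proof.
rewrite /s; have : 3 <= K by rewrite ler_nat.
have : 0 <= L by rewrite ler0n.
have : L + 1 <= K by case/andP: hl => ? ?; rewrite natr1 ler_nat; lia.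
by move=> *; apply: divr_ge0; apply: mulr_ge0; lra.
Qed.

Let inner := \sum_B nb B B / 2.

Let inner_ge0 : 0 <= c * inner.
Proof.
apply: mulr_ge0.
  rewrite /c; have : 3 <= K by rewrite ler_nat.
  have : 0 <= L by rewrite ler0n.
  have : L + 1 <= K by case/andP: hl => ? ?; rewrite natr1 ler_nat; lia.
  move=> *; apply: divr_ge0; last by lra.
  by apply: divr_ge0; [apply: mulr_ge0; lra | apply: sqr_ge0].
apply: sumr_ge0 => B _; apply: divr_ge0 => //; apply: sumr_ge0 => i _.
exact: sumr_ge0.
Qed.

Section FixedA.
Variable A : {set 'I_k}.
Hypothesis cardA : #|A| = l.

Let y := centred_ind R l A.

Let cross_resample B B' f t : B' != B -> cross A B B' (resample f B t) =
  \sum_i (\sum_j adj B B' i j * colour_ind A f (B', j)) * y (t i).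
Proof.
move=> BB; apply: eq_bigr => i _; rewrite mulr_suml; apply: eq_bigr => j _.
by rewrite /colour_ind /= resample_eq resample_neq // -/y; ring.
Qed.

Let diag_resample B f t : cross A B B (resample f B t) =
  \sum_i \sum_j adj B B i j * (y (t i) * y (t j)).
Proof.
apply: eq_bigr => i _; apply: eq_bigr => j _.
by rewrite /colour_ind /= resample_eq.
Qed.

Let block_sym B : symmetric (fun i j => e (B, i) (B, j)).
Proof. by move=> i j; rewrite e_sym. Qed.
Let block_irr B : irreflexive (fun i j => e (B, i) (B, j)).
Proof. by move=> i; rewrite e_irr. Qed.

Let cross_mean B B' f : B' != B ->
  mean (fun t => cross A B B' (resample f B t)) = 0.
Proof.
move=> BB; rewrite (eq_mean (cross_resample f ^~ BB)) mean_sum big1 // => i _.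
by rewrite meanZ (mean_centred R k3 cardA) mulr0.
Qed.

Let term_mean (p : 'I_b * 'I_b) B f : B \in [set p.1; p.2] ->
  mean (fun t => term A p (resample f B t)) = 0.
Proof.
case: p => B1 B2; rewrite !inE /term /=; have [<-|B12] := eqVneq B1 B2.
  rewrite orbb => /eqP ->.
  rewrite (eq_mean (G := fun t : 'S_k =>
     (\sum_i \sum_j adj B1 B1 i j * (y (t i) * y (t j))) / 2
       + c * (nb B1 B1 / 2))).
    exact: (mean_block R k3 cardA (block_irr B1)).
  by move=> t; rewrite diag_resample.
case/orP => /eqP ->; first by rewrite cross_mean // eq_sym.
rewrite (eq_mean (G := fun t => cross A B2 B1 (resample f B2 t))).
  by rewrite cross_mean.
by move=> t; rewrite cross_sym.
Qed.

Let term_sqr (p : 'I_b * 'I_b) :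
  mean (fun f => term A p f ^+ 2) <=
  s ^+ 2 * (if p.1 == p.2 then nb p.1 p.2 / 2 else nb p.1 p.2).
Proof.
case: p => B1 B2; rewrite /term /=; rewrite (mean_resample perm0 _ B1).
have W0 : (0 < #|{: W}|)%N by apply/card_gt0P; exists [ffun=> 1%g].
have [<-|B12] := eqVneq B1 B2.
  rewrite (eq_mean (G := fun f : W => mean (fun t : 'S_k =>
     ((\sum_i \sum_j adj B1 B1 i j * (y (t i) * y (t j))) / 2
       + c * (nb B1 B1 / 2)) ^+ 2))).
    rewrite mean_cst //.
    exact: (mean_block_sqr_le R k3 hl cardA (block_sym B1) (block_irr B1)).
  by move=> f; apply: eq_mean => t; rewrite diag_resample.
have B21 : B2 != B1 by rewrite eq_sym.
pose g i f := \sum_j adj B1 B2 i j * colour_ind A f (B2, j).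
apply: le_trans (_ : mean (fun f : W => s * \sum_i g i f ^+ 2) <= _).
  apply: ler_mean => f.
  rewrite (eq_mean (G := fun t : 'S_k => (\sum_i g i f * y (t i)) ^+ 2)).
    exact: (mean_linear_sqr_le k3 hl cardA).
  by move=> t; rewrite cross_resample.
rewrite meanZ expr2 -mulrA ler_wpM2l // mean_sum /nb mulr_sumr.
rewrite ler_sum // => i _.
rewrite (mean_resample perm0 _ B2).
rewrite -[leRHS](@mean_cst R W) //; apply: ler_mean => f.
rewrite (eq_mean (G := fun t : 'S_k => (\sum_j adj B1 B2 i j * y (t j)) ^+ 2)).
  rewrite (eq_bigr (fun j => adj B1 B2 i j ^+ 2)).
    exact: (mean_linear_sqr_le k3 hl cardA).
  by move=> j _; rewrite /adj -natrX; case: (e _ _).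
move=> t; congr (_ ^+ 2); apply: eq_bigr => j _.
by rewrite /colour_ind /= resample_eq.
Qed.

Let quad f :=
  (\sum_x \sum_y (e x y)%:R * (colour_ind A f x * colour_ind A f y)) / 2.
Let m := (\sum_x \sum_y (e x y)%:R : R) / 2.

Let quadE f :
  quad f + c * inner = \sum_(p : 'I_b * 'I_b | (p.1 <= p.2)%N) term A p f.
Proof.
rewrite /quad pairs_sum half_sum_symmetric; last exact: cross_sym.
have -> : c * inner = \sum_(p : 'I_b * 'I_b | (p.1 <= p.2)%N)
    (if p.1 == p.2 then c * (nb p.1 p.2 / 2) else 0).
  rewrite -big_mkcondr /= /inner mulr_sumr.
  rewrite (reindex (fun i : 'I_b => (i, i))) /=.
    by apply: eq_big => i; rewrite ?leqnn ?eqxx.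
  by exists fst => [i _ //|[i j]]; rewrite inE /= => /andP[_ /eqP ->].
rewrite -big_split /=; apply: eq_bigr => -[B B'] _; rewrite /term /=.
by case: eqP => [->|_] //; rewrite addr0.
Qed.

Lemma mean_quad_centred : mean (fun f => quad f + c * inner) = 0.
Proof.
rewrite (eq_mean quadE) mean_sum big1 // => p _.
rewrite (mean_resample perm0 _ p.1) -[RHS](@mean0 R W).
by apply: eq_mean => f; rewrite term_mean // !inE eqxx.
Qed.

Lemma mean_quad_centred_sqr :
  mean (fun f => (quad f + c * inner) ^+ 2) <= s ^+ 2 * m.
Proof.
rewrite (eq_mean (G := fun f =>
  (\sum_(p : 'I_b * 'I_b | (p.1 <= p.2)%N) term A p f) ^+ 2)); last first.
  by move=> f; rewrite quadE.
rewrite (mean_sum_sqr_orthogonal perm0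
  (P := fun p : 'I_b * 'I_b => (p.1 <= p.2)%N)
  (supp := fun p => [set p.1; p.2])).
- rewrite /m pairs_sum half_sum_symmetric; last exact: nb_sym.
  by rewrite mulr_sumr; apply: ler_sum => p _; apply: term_sqr.
- move=> [i j] [i' j'] /= ij ij' E.
  have : i \in [set i'; j'] by rewrite -E !inE eqxx.
  have : j \in [set i'; j'] by rewrite -E !inE eqxx orbT.
  have : i' \in [set i; j] by rewrite E !inE eqxx.
  have : j' \in [set i; j] by rewrite E !inE eqxx orbT.
  rewrite !inE -!val_eqE /= => h1 h2 h3 h4.
  by congr (_, _); apply: val_inj => /=; lia.
- by move=> p B f t; apply: term_dep.
- by move=> p B f _; apply: term_mean.
Qed.

End FixedA.

(** One colouring serves all sets A: their centred quadratic terms satisfy the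
    hypotheses of [exists_all_le], and the centring constant, being nonnegative,
    may be dropped. *)
Lemma exists_colouring_quad_le :
  exists f : W, forall A : {set 'I_k}, #|A| = l ->
    (\sum_x \sum_y (e x y)%:R * (colour_ind A f x * colour_ind A f y)) / 2 <=
    s * Num.sqrt (('C(k, l)%:R - 1) * ((\sum_x \sum_y (e x y)%:R) / 2)).
Proof.
set m := _ / 2.
have m0 : 0 <= m.
  by apply: divr_ge0 => //; apply: sumr_ge0 => x _; apply: sumr_ge0.
pose J : finType := {A : {set 'I_k} | #|A| == l}.
have cardJ : #|J| = 'C(k, l).
  by rewrite card_sig -[k in 'C(k, _)]card_ord -card_draws cardsE.
have N1 : (1 < #|J|)%N.
  rewrite cardJ; case/andP: hl; case: (k) (l) k3 => // k' [|l'] // _ _ h.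
  by rewrite binS -[2%N]/(1 + 1)%N leq_add // bin_gt0; lia.
have N0 : 0 <= 'C(k, l)%:R - 1 :> R by rewrite subr_ge0 ler1n -cardJ ltnW.
have W0 : (0 < #|W|)%N by apply/card_gt0P; exists [ffun=> 1%g].
have t0 : 0 <= s * Num.sqrt (('C(k, l)%:R - 1) * m).
  by apply: mulr_ge0; [exact: scale_ge0 | exact: sqrtr_ge0].
have tv : (#|J|%:R - 1) * (s ^+ 2 * m) <=
    (s * Num.sqrt (('C(k, l)%:R - 1) * m)) ^+ 2.
  by rewrite [leRHS]exprMn sqr_sqrtr ?(mulr_ge0 N0 m0) // cardJ mulrCA.
have [f Hf] := exists_all_le W0 N1 t0 tv
  (fun A : J => mean_quad_centred (eqP (valP A)))
  (fun A : J => mean_quad_centred_sqr (eqP (valP A))).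
exists f => A /eqP cA; apply: le_trans (Hf (Sub A cA)).
by rewrite /= lerDl inner_ge0.
Qed.

End BlockColouring.

(** * The linear term *)

Section LinearTerm.
Variables (R : rcfType) (k l : nat) (A : {set 'I_k}).
Hypotheses (k3 : (3 <= k)%N) (hl : (1 <= l <= k - 1)%N) (cardA : #|A| = l).

(** As the centred indicators of a block sum to 0, the weights may be shifted
    by lo; then the l places coloured in A contribute at most
    (1 - l / k) (hi - lo) each, and the other ones at most 0. *)
Lemma block_linear_le (w : 'I_k -> R) (f : 'S_k) (lo hi : R) :
  (forall i, lo <= w i <= hi) ->
  \sum_i w i * centred_ind R l A (f i) <=
  l%:R * (k%:R - l%:R) / k%:R * (hi - lo).
Proof.
move=> wb; set p : R := l%:R / k%:R.
have pk : p * k%:R = l%:R by rewrite divfK // pnatr_eq0 -lt0n (leq_trans _ k3).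
have p0 : 0 <= p by rewrite divr_ge0 ?ler0n.
have p1 : p <= 1.
  rewrite ler_pdivrMr ?ltr0n ?(leq_trans _ k3) // mul1r ler_nat.
  by case/andP: hl => _ h; apply: leq_trans h (leq_subr _ _).
have y0 := sum_perm_val (sum_centred_ind R k3 cardA) f.
have -> : \sum_i w i * centred_ind R l A (f i) =
    \sum_i (w i - lo) * centred_ind R l A (f i).
  rewrite [RHS](eq_bigr (fun i => w i * centred_ind R l A (f i)
     - lo * centred_ind R l A (f i))); last by move=> i _; ring.
  by rewrite sumrB -mulr_sumr y0 mulr0 subr0.
apply: le_trans (_ : \sum_i (f i \in A)%:R * ((1 - p) * (hi - lo)) <= _).
  apply: ler_sum => i _; have /andP[wlo whi] := wb i.
  rewrite /centred_ind -/p; case: (f i \in A); rewrite /= ?mulr0n ?mulr1n; nra.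
rewrite -mulr_suml -natr_sum.
have -> : (\sum_i (f i \in A))%N = l.
  rewrite -cardA -sum1_card [RHS]big_mkcond.
  rewrite [RHS](reindex_inj (@perm_inj _ f)) /=.
  by apply: eq_bigr => i _; case: (f i \in A).
rewrite le_eqVlt; apply/orP; left; apply/eqP.
by rewrite -pk; field; rewrite pnatr_eq0 -lt0n (leq_trans _ k3).
Qed.

(** The variations of D over consecutive blocks telescope. *)
Lemma linear_le b (D : nat -> nat) (f : 'I_b -> 'S_k) :
  (forall i j, (i <= j)%N -> (D j <= D i)%N) ->
  \sum_(B < b) \sum_(i < k) (D (B * k + i)%N)%:R * centred_ind R l A (f B i) <=
  l%:R * (k%:R - l%:R) / k%:R * (D 0%N)%:R.
Proof.
move=> Dmono.
have C0 : 0 <= l%:R * (k%:R - l%:R) / k%:R :> R.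
  apply: divr_ge0 => //; apply: mulr_ge0 => //; rewrite subr_ge0 ler_nat.
  by case/andP: hl => _ h; apply: leq_trans h (leq_subr _ _).
apply: le_trans (_ : \sum_(B < b) l%:R * (k%:R - l%:R) / k%:R *
   ((D (B * k)%N)%:R - (D (B.+1 * k)%N)%:R) <= _).
  apply: ler_sum => B _; apply: block_linear_le => i; rewrite !ler_nat.
  apply/andP; split; apply: Dmono; last by rewrite leq_addr.
  by rewrite mulSn addnC leq_add2r ltnW.
rewrite -mulr_sumr ler_wpM2l //.
rewrite -(big_mkord xpredT (fun B => (D (B * k)%N)%:R - (D (B.+1 * k)%N)%:R)).
rewrite (@telescope_sumr_eq _ _ _ (fun B => - (D (B * k)%N)%:R)) // => [|B _].
  by rewrite mul0n opprK addrC lerBlDr lerDl.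
by rewrite opprK addrC.
Qed.

End LinearTerm.

(** * Placing a graph on blocks by decreasing degree *)

Lemma sum_emb (R : rcfType) (V U : finType) (emb : V -> U) (G : U -> R) :
  injective emb -> (forall x, x \notin codom emb -> G x = 0) ->
  \sum_x G x = \sum_v G (emb v).
Proof.
move=> inj G0; transitivity (\sum_(x in emb @: [set: V]) G x).
  rewrite [RHS]big_mkcond; apply: eq_bigr => x _; case: ifPn => // xV.
  apply: G0; apply: contraNN xV => /codomP[v ->].
  by apply/imsetP; exists v.
rewrite big_imset /=; last by move=> u v _ _; apply: inj.
by apply: eq_bigl => v; rewrite inE.
Qed.

(** The image of a graph under an injection; the places outside the image become
    isolated vertices, which is how the incomplete last block is completed. *)
Section Transport.
Variables (V U : finType) (emb : V -> U) (adj : rel V).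
Hypothesis emb_inj : injective emb.

Definition push_rel : rel U :=
  fun x y => [exists u, exists v, [&& emb u == x, emb v == y & adj u v]].

Lemma push_relE u v : push_rel (emb u) (emb v) = adj u v.
Proof.
apply/existsP/idP => [[u' /existsP[v' /and3P[]]]|uv].
  by move=> /eqP/emb_inj -> /eqP/emb_inj ->.
by exists u; apply/existsP; exists v; rewrite !eqxx.
Qed.

Lemma push_rel_codom x y :
  push_rel x y -> (x \in codom emb) && (y \in codom emb).
Proof.
rewrite /push_rel => /existsP[u /existsP[v /and3P[/eqP <- /eqP <- _]]].
by rewrite !codom_f.
Qed.

Lemma push_rel_sym : symmetric adj -> symmetric push_rel.
Proof.
move=> sy x y; rewrite /push_rel.
apply/idP/idP => /existsP[u /existsP[v /and3P[ux vy uv]]];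
  by apply/existsP; exists v; apply/existsP; exists u; rewrite ux vy sy.
Qed.

Lemma push_rel_irr : irreflexive adj -> irreflexive push_rel.
Proof.
move=> ir x; rewrite /push_rel; apply/negbTE/negP.
move=> /existsP[u /existsP[v /and3P[/eqP ux /eqP vy]]].
by rewrite (emb_inj (etrans ux (esym vy))) ir.
Qed.

Lemma sum_push_rel (R : rcfType) (F : U -> U -> R) :
  \sum_x \sum_y (push_rel x y)%:R * F x y =
  \sum_u \sum_v (adj u v)%:R * F (emb u) (emb v).
Proof.
rewrite (@sum_emb _ _ _ emb) //.
  apply: eq_bigr => u _; rewrite (@sum_emb _ _ _ emb) //.
    by apply: eq_bigr => v _; rewrite push_relE.
  move=> y ny; rewrite (_ : push_rel _ _ = false) ?mul0r //.
  by apply: contraNF ny => /push_rel_codom/andP[].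
move=> x nx; apply: big1 => y _; rewrite (_ : push_rel _ _ = false) ?mul0r //.
by apply: contraNF nx => /push_rel_codom/andP[].
Qed.

End Transport.

Section Ordering.
Variables (V : finType) (adj : rel V) (k : nat) (v0 : V).
Hypotheses (k0 : (0 < k)%N) (adj_irr : irreflexive adj).

Definition degree v := #|[pred w | adj v w]|.

Definition by_degree : seq V := sort (relpre degree geq) (enum V).

(** When k divides #|V| the last block is empty; allowing this avoids a case
    distinction. *)
Definition block_number := (#|V| %/ k).+1.

Lemma size_by_degree : size by_degree = #|V|.
Proof. by rewrite size_sort cardE. Qed.

Lemma mem_by_degree v : v \in by_degree.
Proof. by rewrite mem_sort mem_enum. Qed.

Lemma uniq_by_degree : uniq by_degree.
Proof. by rewrite sort_uniq enum_uniq. Qed.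

Definition rank v := index v by_degree.

Lemma rank_lt v : (rank v < #|V|)%N.
Proof. by rewrite -size_by_degree index_mem mem_by_degree. Qed.

Lemma block_lt v : (rank v %/ k < block_number)%N.
Proof. by rewrite ltnS leq_div2r // ltnW // rank_lt. Qed.

Lemma slot_lt v : (rank v %% k < k)%N.
Proof. by rewrite ltn_mod. Qed.

Definition place v : 'I_block_number * 'I_k :=
  (Ordinal (block_lt v), Ordinal (slot_lt v)).

Lemma rank_place v : rank v = ((place v).1 * k + (place v).2)%N.
Proof. by rewrite /= -divn_eq. Qed.

Lemma rank_inj : injective rank.
Proof.
move=> u v uv; rewrite -(nth_index v0 (mem_by_degree u)) -/(rank u) uv.
by rewrite nth_index ?mem_by_degree.
Qed.

Lemma place_inj : injective place.
Proof. by move=> u v uv; apply: rank_inj; rewrite !rank_place uv. Qed.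

Lemma place_onto (x : 'I_block_number * 'I_k) :
  (x.1 * k + x.2 < #|V|)%N -> exists v, place v = x.
Proof.
case: x => B i /= lt; exists (nth v0 by_degree (B * k + i)).
have E : rank (nth v0 by_degree (B * k + i)) = (B * k + i)%N.
  by rewrite /rank index_uniq ?size_by_degree ?uniq_by_degree.
congr (_, _); apply: val_inj; rewrite /= E.
  by rewrite divnMDl // divn_small ?addn0.
by rewrite modnMDl modn_small.
Qed.

(** The default value 0 is the degree of the isolated vertices that complete the
    last block, and keeps the sequence decreasing. *)
Definition degree_at t := nth 0%N (map degree by_degree) t.

Lemma degree_at_rank v : degree_at (rank v) = degree v.
Proof.
rewrite /degree_at (nth_map v0) ?size_by_degree ?rank_lt //.
by rewrite nth_index ?mem_by_degree.
Qed.

Lemma degree_at_mono i j : (i <= j)%N -> (degree_at j <= degree_at i)%N.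
Proof.
move=> ij; have [js|js] := ltnP j (size by_degree); last first.
  by rewrite /degree_at [nth _ _ j]nth_default ?size_map.
have st : sorted geq (map degree by_degree).
  rewrite sorted_map; apply: sort_sorted => u v.
  by rewrite /= leq_total.
have tr : transitive geq by move=> x y z /= h1 h2; apply: leq_trans h2 h1.
apply: (sorted_leq_nth tr (leqnn) 0%N st) => //; rewrite inE size_map //.
exact: leq_ltn_trans ij js.
Qed.

Lemma degree_at0 : (degree_at 0 <= #|V| - 1)%N.
Proof.
rewrite /degree_at; case: by_degree => //= v _.
rewrite /degree subn1 -(cardC1 v) subset_leq_card //.
apply/subsetP => w; rewrite !inE.
by apply: contraTneq => ->; rewrite adj_irr.
Qed.

Lemma sum_degree (R : rcfType) (F : 'I_block_number * 'I_k -> R) :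
  \sum_v (degree v)%:R * F (place v) =
  \sum_(B < block_number) \sum_(i < k)
    (degree_at (B * k + i)%N)%:R * F (B, i).
Proof.
rewrite pair_big /=.
rewrite [RHS](eq_bigr (fun x : 'I_block_number * 'I_k =>
  (degree_at (x.1 * k + x.2)%N)%:R * F x)); last by case.
rewrite [RHS](@sum_emb _ _ _ place) //.
- by apply: eq_bigr => v _; rewrite -degree_at_rank rank_place.
- exact: place_inj.
move=> x nx; rewrite /degree_at nth_default ?mul0r //.
rewrite size_map size_by_degree leqNgt; apply: contraNN nx => /place_onto[v <-].
exact: codom_f.
Qed.

Variable f : 'I_block_number -> 'S_k.

Definition colour v := f (place v).1 (place v).2.

Definition colour_class i := [set v | colour v == i].

Lemma colour_class_kpartition : is_kpartition colour_class.
Proof.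
split=> [i j ij|].
  rewrite -setI_eq0; apply/eqP/setP => v; rewrite !inE.
  by apply/negP => /andP[/eqP -> /eqP E]; rewrite E eqxx in ij.
by apply/setP => v; rewrite inE; apply/bigcupP; exists (colour v); rewrite ?inE.
Qed.

Lemma mem_colour_class (A : {set 'I_k}) v :
  (v \in \bigcup_(i in A) colour_class i) = (colour v \in A).
Proof.
apply/bigcupP/idP => [[i iA]|vA]; first by rewrite inE => /eqP ->.
by exists (colour v); rewrite ?inE.
Qed.

(** A class has exactly one vertex in each of the first #|V| %/ k blocks, which
    are full, and at most one in the last block. *)
Lemma card_colour_class i :
  (block_number.-1 <= #|colour_class i| <= block_number)%N.
Proof.
apply/andP; split.
  have slot (B : 'I_(#|V| %/ k)) : exists v,
      place v == (widen_ord (leqnSn _) B, (f (widen_ord (leqnSn _) B))^-1%g i).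
    set x := (_, _); have [|v <-] := @place_onto x; last by exists v.
    apply: leq_trans (_ : B.+1 * k <= _)%N.
      by rewrite mulSn addnC ltn_add2r.
    by apply: leq_trans (leq_divM #|V| k); rewrite leq_mul2r ltn_ord orbT.
  pose h B := xchoose (slot B).
  have hE B := eqP (xchooseP (slot B)).
  have h_inj : injective h.
    move=> B B' /(congr1 (fun v => val (place v).1)).
    by rewrite !hE /= => /val_inj.
  rewrite -[X in (X <= _)%N]card_ord -(card_imset _ h_inj) subset_leq_card //.
  apply/subsetP => _ /imsetP[B _ ->].
  by rewrite inE /colour hE permKV.
rewrite -[leqRHS]card_ord.
rewrite -(@card_in_imset _ _ (fun v => (place v).1)) ?max_card //.
move=> u v; rewrite !inE /colour => /eqP uE /eqP vE.
move=> uv0; have {uv0} uv : (place u).1 = (place v).1 := uv0; apply: place_inj.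
rewrite uv -vE in uE.
by rewrite [LHS]surjective_pairing [RHS]surjective_pairing uv (perm_inj uE).
Qed.

Lemma colour_class_balanced : balanced colour_class.
Proof.
move=> i j; have := card_colour_class i; have := card_colour_class j.
rewrite /block_number /=; lia.
Qed.

End Ordering.

(** The expansion of the product of y u + p and y v + p over the edges uv. *)
Lemma edges_within_shift (R : rcfType) (V : finType) (adj : rel V) (S : {set V})
    (y : V -> R) (p : R) :
  symmetric adj -> irreflexive adj -> (forall v, (v \in S)%:R = y v + p) ->
  (edges_within adj S)%:R = p ^+ 2 * #|edges adj|%:R
    + p * (\sum_v (degree adj v)%:R * y v)
    + (\sum_u \sum_v (adj u v)%:R * (y u * y v)) / 2.
Proof.
move=> sy ir Sy.
have E := sum_darts R S sy ir.
have ET := sum_darts R [set: V] sy ir; rewrite edges_within_setT in ET.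
have degE v : (degree adj v)%:R = \sum_w (adj v w)%:R :> R.
  rewrite /degree -sum1_card natr_sum big_mkcond; apply: eq_bigr => w _.
  by rewrite inE; case: (adj v w).
set dy := \sum_v (degree adj v)%:R * y v.
have H : \sum_u \sum_v (adj u v)%:R * ((u \in S)%:R * (v \in S)%:R) =
    \sum_u \sum_v (adj u v)%:R * (y u * y v) + (p * dy + p * dy)
    + p ^+ 2 * (\sum_u \sum_v
        (adj u v)%:R * ((u \in [set: V])%:R * (v \in [set: V])%:R)).
  have -> : p * dy + p * dy =
      \sum_u \sum_v (p * ((adj u v)%:R * y u) + p * ((adj u v)%:R * y v)).
    rewrite /dy.
    under [RHS]eq_bigr do rewrite big_split /=.
    rewrite big_split /= [X in _ = _ + X]exchange_big /=.
    rewrite !mulr_sumr; congr (_ + _); apply: eq_bigr => u _;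
      rewrite degE mulr_suml mulr_sumr //.
    by apply: eq_bigr => v _; rewrite sy.
  rewrite mulr_sumr -!big_split /=; apply: eq_bigr => u _.
  rewrite mulr_sumr -!big_split /=; apply: eq_bigr => v _.
  by rewrite !Sy !inE /=; ring.
have -> : (edges_within adj S)%:R = (2 * (edges_within adj S)%:R) / 2 :> R.
  by field.
by rewrite -E H ET; field.
Qed.

(** * The bound *)

Theorem theorem1p2 (R : rcfType) (k l : nat) (hk : (3 <= k)%N)
    (hl : (1 <= l <= k - 1)%N)
    (V : finType) (adj : rel V)
    (adj_sym : symmetric adj) (adj_irr : irreflexive adj)
    (n m : nat) (hn : (1 <= n)%N) (cardV : #|V| = n) (cardE : #|edges adj| = m) :
  exists P : 'I_k -> {set V},
    [/\ is_kpartition P, balanced P &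
      (\max_(A : {set 'I_k} | #|A| == l)
          edges_within adj (\bigcup_(i in A) P i))%N%:R
      <= l%:R ^+ 2 / k%:R ^+ 2 * m%:R
         + l%:R ^+ 2 * (k%:R - l%:R) / k%:R ^+ 2 * (n%:R - 1)
         + l%:R * (k%:R - l%:R) / (k%:R * (k%:R - 1))
           * Num.sqrt (('C(k, l)%:R - 1) * m%:R) :> R].
Proof.
have k0 : (0 < k)%N by apply: leq_trans hk.
have [v0 _] : exists v0 : V, v0 \in V by apply/card_gt0P; rewrite cardV.
pose pl := place adj k0.
have pl_inj : injective pl := place_inj v0 (k0 := k0).
pose e := push_rel pl adj.
have e_sym : symmetric e := push_rel_sym pl adj_sym.
have e_irr : irreflexive e := push_rel_irr pl_inj adj_irr.
have [f Hf] := exists_colouring_quad_le R hk hl e_sym e_irr.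
exists (colour_class adj k0 f); split.
- exact: colour_class_kpartition.
- exact: (colour_class_balanced adj v0 k0 f).
set K : R := k%:R; set L : R := l%:R.
have K3 : 3 <= K by rewrite ler_nat.
have L0 : 0 <= L by [].
have LK : L <= K.
  rewrite ler_nat; case/andP: hl => _ h.
  exact: leq_trans h (leq_subr _ _).
have n1 : 0 <= n%:R - 1 :> R by rewrite subr_ge0 ler1n.
set B := (X in _ <= X).
have B0 : 0 <= B.
  rewrite /B; apply: addr_ge0; first apply: addr_ge0.
  - by rewrite mulr_ge0 // divr_ge0 ?sqr_ge0.
  - rewrite mulr_ge0 // divr_ge0 ?sqr_ge0 // mulr_ge0 ?sqr_ge0 //; lra.
  - apply: mulr_ge0; last exact: sqrtr_ge0.
    by apply: divr_ge0; apply: mulr_ge0; lra.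
apply: (big_ind (fun x : nat => x%:R <= B)) => // [x y|A /eqP cA].
  by case: (leqP x y) => xy; rewrite ?(maxn_idPr xy) ?(maxn_idPl (ltnW xy)).
set S := \bigcup_(i in A) _.
pose y v := colour_ind R l A f (pl v).
have yE v : (v \in S)%:R = y v + L / K.
  by rewrite mem_colour_class /y /colour_ind /centred_ind subrK.
rewrite (edges_within_shift adj_sym adj_irr yE) cardE /B.
have p0 : 0 <= L / K by apply: divr_ge0; lra.
apply: lerD; first apply: lerD.
- by rewrite expr_div_n.
- have -> : L ^+ 2 * (K - L) / K ^+ 2 * (n%:R - 1) =
     L / K * (L * (K - L) / K * (n%:R - 1)).
    by field; apply: lt0r_neq0; lra.
  apply: ler_wpM2l => //.
  rewrite (sum_degree adj v0 k0 (fun x => colour_ind R l A f x)).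
  apply: le_trans (linear_le R hk hl cA f (@degree_at_mono V adj)) _.
  apply: ler_wpM2l.
    by apply: divr_ge0; [apply: mulr_ge0; lra | lra].
  have -> : n%:R - 1 = (n - 1)%N%:R :> R by rewrite natrB.
  by rewrite ler_nat -cardV; apply: degree_at0.
have := Hf A cA.
rewrite /e (sum_push_rel adj pl_inj
  (fun x z => colour_ind R l A f x * colour_ind R l A f z)).
move=> h; apply: le_trans h _; rewrite -/K -/L.
have -> // : (\sum_x \sum_y0 (push_rel pl adj x y0)%:R) / 2 = m%:R :> R.
have := sum_push_rel adj pl_inj (fun _ _ => 1 : R).
under eq_bigr do under eq_bigr do rewrite mulr1.
move=> ->; rewrite -cardE -edges_within_setT.
have := sum_darts R [set: V] adj_sym adj_irr.
under eq_bigr do under eq_bigr do rewrite !inE /= mulr1n mulr1.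
by move=> ->; field.
Qed.
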